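(* Let $V$ be a real vector space of dimension $r$ and $\mathcal{A}$ a finite set of distinct linear hyperplanes in $V$ whose common intersection is $\{0\}$. If $\mathcal{A}$ satisfies Yoshinaga's criterion, then $\mathcal{A}$ is formal.
   Context: Choose for each $H\in\mathcal{A}$ a coorientation, labelling the components of $V\setminus H$ as $H^+,H^-$. For $\epsilon\in\{\pm\}^{\mathcal{A}}$ and $S\subseteq\mathcal{A}$, $H_S^\epsilon=\bigcap_{H\in S}H^{\epsilon_H}$; $\epsilon$ is $k$-consistent if $H_S^\epsilon\neq\emptyset$ for all $S$ with $|S|\le k+1$, $\sigma_k$ is the number of $k$-consistent sign vectors, and $\mathcal{A}$ satisfies Yoshinaga's criterion if $\sigma_2=\sigma_r$. For each $H$ choose $\alpha_H\in V^*$ with $H=\ker\alpha_H$, and let $\pi:\mathbb{R}^{\mathcal{A}}\to V^*$ send the basis vector $e_H$ to $\alpha_H$. A flat is a subset $F\subseteq\mathcal{A}$ with $F=\{H\in\mathcal{A}:H\supseteq\bigcap_{G\in F}G\}$, of rank equal to the codimension of $\bigcap_{G\in F}G$. $\mathcal{A}$ is formal if $\ker\pi=\sum_{F\text{ flat of rank }2}\ker(\pi|_{\mathbb{R}^F})$, where $\mathbb{R}^F\subseteq\mathbb{R}^{\mathcal{A}}$ is the coordinate subspace; equivalently, all linear relations among the $\alpha_H$ are generated by relations among the forms of hyperplanes in rank-2 flats. *)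

(* Defs.v *)
From HB Require Import structures.
From mathcomp Require Import all_boot all_order all_algebra finmap.
From mathcomp Require Import all_classical all_reals topology normedtype.

Set Implicit Arguments.
Unset Strict Implicit.
Unset Printing Implicit Defensive.

Import Order.TTheory GRing.Theory Num.Theory.
Import numFieldNormedType.Exports.

Local Open Scope classical_set_scope.
Local Open Scope ring_scope.

Section Arrangement.
Context {R : realType} {V : vectType R}.

Definition is_hyperplane (H : {vspace V}) : Prop :=
  (\dim H).+1 = \dim {:V}.

(* [V] carries the usual topology of a finite-dimensional real vector space,
   read off in coordinates: the coordinate map to R^n is a homeomorphism. *)
Definition coords (v : V) : 'rV[R]_(\dim {:V}) :=
  \row_i coord (vbasis {:V}) i v.

(* The set of connected components of the subset [X] of [V]. *)
Definition components (X : set V) : set (set V) :=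
  [set coords @^-1` (connected_component (coords @` X) (coords x)) | x in X].

Variable A : {fset {vspace V}}.

Definition is_essential_arrangement : Prop :=
  (forall H : A, is_hyperplane (val H)) /\
  (\bigcap_(H : A) val H = 0)%VS.

(* [side H true] is H^+ and [side H false] is H^-. *)
Definition is_coorientation (side : A -> bool -> set V) : Prop :=
  forall H : A, injective (side H) /\
    range (side H) = components (~` [set v | v \in val H]).

Section Consistency.
Variable side : A -> bool -> set V.

Definition sign_inter (eps : {ffun A -> bool}) (S : {set A}) : set V :=
  \bigcap_(H in [set` S]) side H (eps H).

Definition consistent (k : nat) (eps : {ffun A -> bool}) : Prop :=
  forall S : {set A}, (#|S| <= k.+1)%N -> sign_inter eps S !=set0.

Definition sigma (k : nat) : nat :=
  #|[pred eps : {ffun A -> bool} | `[< consistent k eps >]]|.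

Definition yoshinaga (r : nat) : Prop := sigma 2 = sigma r.

End Consistency.

Definition flat_space (F : {set A}) : {vspace V} := (\bigcap_(G in F) val G)%VS.

Definition is_flat (F : {set A}) : bool :=
  F == [set H : A | (flat_space F <= val H)%VS]%SET.

Definition flat_rank (F : {set A}) : nat :=
  (\dim {:V} - \dim (flat_space F))%N.

(* The dual space V^* is ['Hom(V, R^o)], and R^A is [{ffun A -> R^o}]. *)
Section Formality.
Variable alpha : A -> 'Hom(V, R^o).

Definition is_defining_forms : Prop := forall H : A, lker (alpha H) = val H.

Definition pi_fun (c : {ffun A -> R^o}) : 'Hom(V, R^o) :=
  \sum_(H : A) (c H : R) *: alpha H.

Lemma pi_fun_is_linear : linear pi_fun.
Proof.
move=> a c d; rewrite /pi_fun scaler_sumr -big_split /=.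
by apply: eq_bigr => H _; rewrite !ffunE scalerDl scalerA.
Qed.

HB.instance Definition _ :=
  GRing.isLinear.Build R {ffun A -> R^o} 'Hom(V, R^o) _ pi_fun pi_fun_is_linear.

Definition form_map : 'Hom({ffun A -> R^o}, 'Hom(V, R^o)) := linfun pi_fun.

Definition basis_vec (H : A) : {ffun A -> R^o} := [ffun G => (G == H)%:R].

Definition coord_subspace (F : {set A}) : {vspace {ffun A -> R^o}} :=
  (\sum_(H in F) <[basis_vec H]>)%VS.

Definition formal : Prop :=
  lker form_map =
  (\sum_(F : {set A} | is_flat F && (flat_rank F == 2%N))
     (lker form_map :&: coord_subspace F))%VS.

End Formality.
End Arrangement.

(* Main.v *)
(** A relation [k] among the forms that is not generated by rank-2 relations,
    chosen with minimal support, has support of size at most [r + 1], and no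
    nonzero rank-2-generated relation is supported in [supp k].  Hence some [w]
    in R^A orthogonal to all rank-2 relations agrees with [k] on [supp k], and
    moving [w] slightly by the values of the forms at a generic point makes all
    its entries nonzero.  All relations among at most three forms are rank-2
    relations, so on any three hyperplanes [w] takes the values of the forms at
    some vector: the sign vector of [w] is 2-consistent.  By Yoshinaga's
    criterion it is r-consistent, so some [v] has [k_H * alpha_H v > 0] for all
    [H] in [supp k], contradicting [sum_H k_H alpha_H = 0]. *)
From HB Require Import structures.
Require Import Defs.
From mathcomp Require Import all_boot all_order all_algebra finmap.
From mathcomp Require Import all_classical all_reals topology normedtype.
From mathcomp Require Import lra zify.

Set Implicit Arguments.
Unset Strict Implicit.
Unset Printing Implicit Defensive.

Import Order.TTheory GRing.Theory Num.Theory.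
Import numFieldNormedType.Exports.
Local Open Scope ring_scope.
Local Open Scope classical_set_scope.

(** Take [t = 1/s] with [s] larger than every [|b i| / |a i|]: then [|t * b i| < |a i|] whenever
    [a i] is nonzero, so the added term cannot change the sign. *)
Lemma sign_preserving_perturbation (R : realFieldType) (I : finType)
    (a b : I -> R) :
  exists2 t : R, 0 < t & forall i, a i != 0 -> 0 < a i * (a i + t * b i).
Proof.
pose s := 1 + \sum_i `|b i| / `|a i|.
have term_ge0 i : 0 <= `|b i| / `|a i| by rewrite divr_ge0.
have s_gt0 : 0 < s by rewrite ltr_pwDl // sumr_ge0.
exists s^-1 => [|i ai0]; first by rewrite invr_gt0.
have ai_gt0 : 0 < `|a i| by rewrite normr_gt0.
have : `|b i| / `|a i| < s.
  rewrite /s (bigD1 i) //= addrCA ltrDl ltr_pwDl // sumr_ge0 //.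
rewrite ltr_pdivrMr // mulrC -ltr_pdivrMr // => small.
have -> : a i * (a i + s^-1 * b i) = a i ^+ 2 + a i * b i / s.
  by rewrite mulrDr -expr2; congr (_ + _); rewrite mulrCA mulrC.
have : `|a i * b i / s| < a i ^+ 2.
  rewrite !normrM -(real_normK (num_real (a i))) expr2 -mulrA.
  by rewrite (gtr0_norm (x := s^-1)) ?invr_gt0 // ltr_pM2l.
by rewrite ltr_norml => /andP[]; lra.
Qed.

(** * Open half-spaces as connected components *)

Section Halfspace.
Variables (R : realType) (V : vectType R) (f : 'Hom(V, R^o)).

(** The form [f] read in coordinates, where the topology lives. *)
Let g (y : 'rV[R]_(\dim {:V})) : R :=
  \sum_i y 0 i * (f (vbasis {:V})`_i : R).

Lemma sum_coords v : g (coords v) = f v.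
Proof.
rewrite {2}(coord_vbasis (memvf v)) linear_sum /g.
by apply: eq_bigr => i _; rewrite mxE linearZ.
Qed.

Lemma sum_coords_continuous : continuous g.
Proof.
apply: (continuous_big (op := +%R)) => [|i _]; first exact: add_continuous.
by move=> y; apply: (@cvgM _ _ (nbhs y) (nbhs_filter y));
  [exact: coord_continuous|exact: cvg_cst].
Qed.

Lemma coords_linear (a : R) (u v : V) : coords (a *: u + v) = a *: coords u + coords v.
Proof. by apply/rowP => i; rewrite !mxE linearP. Qed.

(** The half-space is convex, so segments join each of its points to a base point [x0]; conversely a
    connected set avoiding the kernel cannot contain both signs of [f], by the intermediate value
    property. *)
Lemma halfspace_component : f != 0 ->
  components (~` [set v | v \in lker f]) [set v | 0 < (f v : R)].
Proof.
move=> f0; set X := ~` _.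
have XE v : X v <-> (f v : R) != 0.
  by rewrite /X /= memv_ker; split => /negP.
have [x fx0] : exists x, (f x : R) != 0.
  apply: contrapT => h; case/negP: f0; apply/eqP/lfunP => x.
  rewrite lfunE /=; apply/eqP; apply: contrapT => /negP h'; exact: (h (ex_intro _ x h')).
have [x0 fx0_gt0] : exists x0, 0 < (f x0 : R).
  exists ((f x : R) *: x); rewrite linearZ /=.
  by change (0 < (f x : R) * (f x : R)); rewrite -expr2 exprn_even_gt0.
exists x0; first by apply/XE; rewrite gt_eqF.
apply/seteqP; split => v /=; last first.
  move=> fv.
  pose p (t : R) := coords x0 + t *: (coords v - coords x0).
  have pE t : p t = coords (t *: (v - x0) + x0).
    rewrite coords_linear (addrC v) -scaleN1r coords_linear scaleN1r.
    by rewrite /p addrC (addrC (coords v)).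
  apply: (@connected_component_max _ (coords @` X) (p @` `[0, 1])).
  - by exists 0; rewrite /= ?in_itv /= ?lexx ?ler01 // /p scale0r addr0.
  - move=> _ [t + <-]; rewrite /= in_itv /= => /andP[t0 t1]; rewrite pE.
    exists (t *: (v - x0) + x0) => //; apply/XE.
    rewrite linearP linearB gt_eqF //=.
    change (0 < t * ((f v : R) - (f x0 : R)) + (f x0 : R)).
    have := mulr_ge0 t0 (ltW fv).
    have : 0 <= (1 - t) * (f x0 : R) by rewrite mulr_ge0 ?subr_ge0 // ltW.
    case: (eqVneq t 1) => [->|tn1]; first by move: fv; lra.
    have : 0 < (1 - t) * (f x0 : R) by rewrite mulr_gt0 // subr_gt0 lt_neqAle tn1.
    lra.
  - apply: connected_continuous_connected; first exact: segment_connected.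
    apply: continuous_subspaceT => t.
    by apply: cvgD; [exact: cvg_cst|apply: cvgZr_tmp].
  - by exists 1; rewrite /= ?in_itv /= ?lexx ?ler01 // /p scale1r addrC subrK.
case=> C [Cx0 CX Cc] Cv.
(* The image of [C] is an interval containing [f x0 > 0]. If also [f v <= 0], it would contain 0,
   which [C] avoids. *)
have /connected_intervalP gC : connected (g @` C).
  apply: connected_continuous_connected => //.
  exact/continuous_subspaceT/sum_coords_continuous.
rewrite ltNge; apply/negP => fv.
have : (g @` C) 0.
  apply: (gC (g (coords v)) (g (coords x0))); [by exists (coords v)|by exists (coords x0)|].
  by rewrite !sum_coords fv ltW.
by case=> _ /[dup] /CX[z /XE fz <-] _; rewrite sum_coords => /eqP; rewrite (negPf fz).
Qed.
End Halfspace.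

(** * Duality in the coordinate space R^A *)

Section CoordinateSpace.
Variables (R : realType) (V : vectType R) (A : {fset {vspace V}}).
Implicit Types (c : {ffun A -> R^o}) (w : A -> R) (S T : {set A}).

Definition dot c w : R := \sum_H (c H : R) * w H.

Lemma ffun_neq0 c : c != 0 -> exists H, (c H : R) != 0.
Proof.
move=> c0; apply/existsP; apply: contraR c0.
rewrite negb_exists => /forallP h; apply/eqP/ffunP => H.
by rewrite [RHS]ffunE; have /negPn/eqP := h H.
Qed.

Lemma dot_linear w (a : R) c d : dot (a *: c + d) w = a * dot c w + dot d w.
Proof.
rewrite /dot mulr_sumr -big_split /=; apply: eq_bigr => H _.
by rewrite !ffunE mulrDl -mulrA.
Qed.

Lemma ffun_basis_vec c : c = \sum_H (c H : R) *: basis_vec H.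
Proof.
apply/ffunP => G; rewrite sum_ffunE (bigD1 G) //= big1 => [|H HG].
  by rewrite !ffunE eqxx addr0; exact/esym/mulr1.
by rewrite !ffunE eq_sym (negPf HG); exact: mulr0.
Qed.

Lemma linear_dot (phi : {linear {ffun A -> R^o} -> R^o}) c :
  phi c = dot c (fun H => phi (basis_vec H)).
Proof.
by rewrite {1}(ffun_basis_vec c) linear_sum; apply: eq_bigr => H _; rewrite linearZ.
Qed.

Lemma coord_subspaceP S c :
  reflect (forall H, H \notin S -> c H = 0) (c \in coord_subspace S).
Proof.
apply: (iffP memv_sumP) => [[vs vsP ->] H HS|c0].
  rewrite sum_ffunE big1 // => G GS.
  have /vlineP[a ->] := vsP _ GS.
  rewrite !ffunE; case: eqP => [HG|_]; first by rewrite HG GS in HS.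
  exact: mulr0.
exists (fun H => (c H : R) *: basis_vec H) => [H _|].
  by rewrite memvZ // memv_line.
rewrite [LHS]ffun_basis_vec [LHS](bigID (fun H => H \in S)) /= [X in _ + X]big1 ?addr0 //.
by move=> H /c0 ->; rewrite scale0r.
Qed.

Lemma dim_coord_subspace S : \dim (@coord_subspace R V A S) = #|S|.
Proof.
have dx : directv (\sum_(H in S) <[@basis_vec R V A H]>).
  apply/directv_sum_independent => us usP us0 H HS.
  have /vlineP[a aE] := usP H HS; rewrite aE.
  have /(congr1 (fun c : {ffun A -> R^o} => c H)) := us0.
  rewrite sum_ffunE (bigD1 H) //= big1 => [|G /andP[GS GH]]; last first.
    have /vlineP[b ->] := usP G GS.
    by rewrite !ffunE eq_sym (negPf GH); exact: mulr0.
  rewrite aE !ffunE eqxx addr0.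
  by move/eqP; rewrite scaler_eq0 (oner_eq0 R) orbF => /eqP ->; rewrite scale0r.
rewrite /coord_subspace (directvP dx) /= -sum1_card.
apply: eq_bigr => H _; rewrite dim_vline.
case: eqP => // /ffunP/(_ H); rewrite !ffunE eqxx => /eqP.
by rewrite (oner_eq0 R).
Qed.

(** The residual of a projection onto [U] vanishes on [U] but not at [c]; a nonzero coordinate of
    this residual is the required functional. *)
Lemma orthogonal_separation (U : {vspace {ffun A -> R^o}}) c : c \notin U ->
  exists w, (forall u, u \in U -> dot u w = 0) /\ dot c w != 0.
Proof.
move=> cU.
have d0 : c - projv U c != 0.
  apply: contraNneq cU => /eqP; rewrite subr_eq0 => /eqP ->.
  exact: memv_proj.
have [G dG] := ffun_neq0 d0.
have philin : linear (fun u => (u - projv U u) G : R^o).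
  move=> a u v; rewrite linearP !ffunE opprD addrACA scalerBr.
  by congr (_ + _).
pose phi : {linear {ffun A -> R^o} -> R^o} :=
  HB.pack (fun u => (u - projv U u) G : R^o) (GRing.isLinear.Build R _ R^o _ _ philin).
exists (fun H => phi (basis_vec H)); split => [u uU|]; rewrite -linear_dot //.
by rewrite /= projv_id // subrr ffunE.
Qed.

(** As [U] and R^S are independent, pairing with [w] after projecting to R^S along [U] is a linear
    functional on all of R^A that kills [U] and is unchanged on R^S. *)
Lemma orthogonal_extension (U : {vspace {ffun A -> R^o}}) S w :
    (U :&: coord_subspace S)%VS = 0%VS ->
  exists x, (forall u, u \in U -> dot u x = 0) /\ {in S, x =1 w}.
Proof.
rewrite capvC => disj; set p := daddv_pi (coord_subspace S) U.
have philin : linear (fun u => dot (p u) w : R^o).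
  by move=> a u v; rewrite linearP dot_linear.
pose phi : {linear {ffun A -> R^o} -> R^o} :=
  HB.pack (fun u => dot (p u) w : R^o) (GRing.isLinear.Build R _ R^o _ _ philin).
exists (fun H => phi (basis_vec H)); split => [u uU|H HS].
  rewrite -linear_dot /=.
  (* The two projections of [u] add up to [u], and the one onto [U] is already [u]; hence
     [p u = 0]. *)
  have := daddv_pi_add disj (subvP (addvSr _ _) _ uU).
  rewrite (daddv_pi_id _ uU) 1?capvC // -/p => /eqP.
  rewrite -[X in _ == X]add0r => /eqP/addIr ->.
  by rewrite /dot big1 // => G _; rewrite ffunE mul0r.
rewrite /= /p daddv_pi_id //; last first.
  by apply/coord_subspaceP => G GS; rewrite ffunE; case: eqP => // GH; rewrite GH HS in GS.
rewrite /dot (bigD1 H) //= big1 ?ffunE ?eqxx ?mul1r ?addr0 // => G GH.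
by rewrite ffunE (negPf GH) mul0r.
Qed.

Variable alpha : A -> 'Hom(V, R^o).

Lemma form_mapE c v : form_map alpha c v = dot c (fun H => alpha H v).
Proof.
rewrite lfunE /= /pi_fun sum_lfunE; apply: eq_bigr => H _.
by rewrite scale_lfunE.
Qed.

Lemma form_relationP c :
  reflect (forall v, dot c (fun H => alpha H v) = 0) (c \in lker (form_map alpha)).
Proof.
rewrite memv_ker; apply: (iffP eqP) => [c0 v|c0].
  by rewrite -form_mapE c0 lfunE.
by apply/lfunP => v; rewrite form_mapE c0 lfunE.
Qed.

(** Fredholm alternative for the evaluation map from V to R^S: were [w] outside its image, a
    separating functional cut down to [S] would be a relation among the forms not orthogonal to
    [w]. *)
Lemma forms_interpolation S w :
    (forall c, c \in lker (form_map alpha) -> c \in coord_subspace S ->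
      dot c w = 0) ->
  exists v, forall H, H \in S -> alpha H v = w H.
Proof.
move=> worth.
have Llin : linear (fun v => [ffun H => if H \in S then alpha H v else 0] : {ffun A -> R^o}).
  move=> a u v; apply/ffunP => H; rewrite !ffunE.
  by case: ifP => _; rewrite ?linearP // scaler0 addr0.
pose L : {linear V -> {ffun A -> R^o}} :=
  HB.pack (fun v => [ffun H => if H \in S then alpha H v else 0] : {ffun A -> R^o})
   (GRing.isLinear.Build R _ _ _ _ Llin).
pose t : {ffun A -> R^o} := [ffun H => if H \in S then w H else 0].
have [/memv_imgP[v _ tE]|] := boolP (t \in limg (linfun L)).
  exists v => H HS; have /ffunP/(_ H) := tE.
  by rewrite lfunE /= !ffunE HS.
case/orthogonal_separation => x [xL /negP[]].
pose c : {ffun A -> R^o} := [ffun H => if H \in S then x H else 0].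
have dotC (y : A -> R) : dot [ffun H => if H \in S then y H else 0] x = dot c y.
  apply: eq_bigr => H _; rewrite !ffunE; case: ifP => _; last by rewrite !mul0r.
  exact: mulrC.
rewrite dotC worth //.
  apply/form_relationP => v; rewrite -dotC.
  by have := xL _ (memv_img (linfun L) (memvf v)); rewrite lfunE.
by apply/coord_subspaceP => H HS; rewrite ffunE (negPf HS).
Qed.

End CoordinateSpace.

(** * Kernel vectors of minimal support *)

Section MinimalSupport.
Variables (R : realType) (V : vectType R) (A : {fset {vspace V}}).
Local Notation E := {ffun A -> R^o}.

Definition supp (c : E) : {set A} := [set H | c H != 0]%SET.

Lemma supp_subset (S : {set A}) (c : E) : c \in coord_subspace S -> supp c \subset S.
Proof.
by move/coord_subspaceP => c0; apply/fintype.subsetP => H; rewrite inE; apply: contraR => /c0 ->.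
Qed.

Lemma minimal_support (W : vectType R) (f : 'Hom(E, W)) (U : {vspace E}) :
    ~~ (lker f <= U)%VS ->
  exists c, [/\ c \in lker f, c \notin U,
    (U :&: lker f :&: coord_subspace (supp c))%VS = 0%VS &
    (#|supp c| <= (\dim {:W}).+1)%N].
Proof.
case/subvPn => c0 c0f c0U.
have ex : exists n, `[< exists c, [/\ c \in lker f, c \notin U & #|supp c| = n] >].
  by exists #|supp c0|; apply/asboolP; exists c0.
case: (ex_minnP ex) => n /asboolP[c [cf cU cn]] minn; exists c.
have cmin d : d \in lker f -> d \notin U -> (#|supp c| <= #|supp d|)%N.
  by move=> df dU; rewrite cn; apply: minn; apply/asboolP; exists d.
have disj d : d \in U -> d \in lker f -> d \in coord_subspace (supp c) -> d = 0.
  move=> dU df /coord_subspaceP dc; apply/eqP/negP => /negP d0.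
  have [G dG] := ffun_neq0 d0.
  (* The scalar is chosen to cancel coordinate [G]. Then [e] is still in the kernel and outside [U],
     but has strictly smaller support. *)
  pose e := c - ((c G : R) / (d G : R)) *: d.
  have : (#|supp c| <= #|supp e|)%N.
    apply: cmin; first by rewrite memvB ?memvZ.
    by apply: contra cU => eU; rewrite -(subrK (((c G : R) / (d G : R)) *: d) c) memvD ?memvZ.
  apply/negP; rewrite -ltnNge; apply: proper_card; apply/properP; split.
    apply/fintype.subsetP => H; rewrite !inE; apply: contraR; rewrite negbK => /eqP cH.
    have dH : d H = 0 by apply: dc; rewrite inE cH eqxx.
    by rewrite !ffunE cH dH scaler0 subrr.
  exists G; first by rewrite inE; apply: contra dG => /eqP cG; rewrite dc // inE cG eqxx.
  rewrite inE negbK !ffunE subr_eq0; apply/eqP.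
  by rewrite -[RHS]/((c G : R) / (d G : R) * (d G : R)) divfK.
split=> //.
  apply/eqP; rewrite -subv0; apply/subvP => d; rewrite !memv_cap memv0.
  by case/andP => /andP[dU df] dc; rewrite (disj d).
(* Otherwise, dropping one index from the support leaves more than [\dim {:W}] coordinates, so the
   kernel meets R^T in some nonzero [d]. Outside [U] it contradicts minimality, inside [U] it
   contradicts [disj]. *)
rewrite leqNgt; apply/negP => big.
have [G Gc] : exists G, G \in supp c.
  by apply/set0Pn; rewrite -card_gt0; lia.
pose T : {set A} := (supp c :\ G)%SET.
have dimT : \dim (@coord_subspace R V A T :&: lker f)%VS <> 0%N.
  have := limg_ker_dim f (@coord_subspace R V A T).
  have := dimvS (subvf (f @: @coord_subspace R V A T)).
  have := cardsD1 G (supp c); rewrite Gc -/T dim_coord_subspace.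
  by move: big => + Tc Sle Ssum S0; rewrite Tc add1n ltnS -Ssum S0 add0n ltnNge Sle.
have : (coord_subspace T :&: lker f != 0 :> {vspace E})%VS.
  by apply/eqP => h; apply: dimT; rewrite h dimv0.
rewrite -vpick0; set d := vpick _ => d0.
have : d \in (coord_subspace T :&: lker f)%VS by exact: memv_pick.
rewrite memv_cap => /andP[dT df].
have dTs := supp_subset dT.
have dsub : d \in coord_subspace (supp c).
  apply/coord_subspaceP => H Hc; move/coord_subspaceP: dT; apply.
  by rewrite inE (negPf Hc) andbF.
have [dU|dU] := boolP (d \in U); first by rewrite (disj d) ?eqxx in d0.
have := cmin _ df dU; have := subset_leq_card dTs.
by have := cardsD1 G (supp c); rewrite Gc -/T; lia.
Qed.
End MinimalSupport.

(** * Relations among few forms, generic points, and sides of hyperplanes *)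

Section Arrangement.
Variables (R : realType) (V : vectType R) (A : {fset {vspace V}}).
Hypothesis hypA : forall H : A, is_hyperplane (val H).
Variable alpha : A -> 'Hom(V, R^o).
Hypothesis alphaA : is_defining_forms alpha.

Definition rank2_relations : {vspace {ffun A -> R^o}} :=
  (\sum_(F : {set A} | is_flat F && (flat_rank F == 2%N))
     (lker (form_map alpha) :&: coord_subspace F))%VS.

Lemma hyperplane_inj (G H : A) : (val G <= val H)%VS -> G = H.
Proof.
move=> GH; apply/val_inj/eqP; rewrite eqEdim GH.
by have := hypA G; have := hypA H; rewrite /is_hyperplane; lia.
Qed.

Lemma dim_hyperplane_cap (G H : A) : G != H ->
  (\dim (val G :&: val H)%VS).+2 = \dim {:V}.
Proof.
move=> GH; have := dimv_sum_cap (val G) (val H).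
have := hypA G; have := hypA H; rewrite /is_hyperplane.
have := dimvS (subvf (val G + val H)%VS).
have := dimv_leqif_sup (addvSl (val G) (val H)); case=> _ e.
have : (\dim (val G) < \dim (val G + val H))%N.
  rewrite ltn_neqAle dimvS ?addvSl // e andbT; apply: contra GH => h.
  by apply/eqP/esym/hyperplane_inj; exact: subv_trans (addvSr _ _) h.
lia.
Qed.

(** If [c] is nonzero at [H0], the form of [H0] is a combination of the at most two others, so [S]
    has an intersection of codimension exactly 2 and [c] lives on the rank-2 flat generated by
    [S]. *)
Lemma small_relation (S : {set A}) c : (#|S| <= 3)%N ->
  c \in lker (form_map alpha) -> c \in coord_subspace S -> c \in rank2_relations.
Proof.
move=> S3 cK cS; have [->|c0] := eqVneq c 0; first exact: mem0v.
have [H0 cH0] := ffun_neq0 c0.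
have H0S : H0 \in S by apply: (fintype.subsetP (supp_subset cS)); rewrite inE.
pose T : {set A} := (S :\ H0)%SET.
have TH0 : (flat_space T <= val H0)%VS.
  apply/subvP => v vT; rewrite -alphaA memv_ker.
  have /form_relationP/(_ v) := cK; rewrite /dot (bigD1 H0) //= big1 => [|H HH0].
    by rewrite addr0 => /eqP; rewrite mulf_eq0 (negPf cH0).
  have [HS|HS] := boolP (H \in S); last first.
    by move/coord_subspaceP: cS => ->; rewrite ?mul0r.
  suff /eqP -> : alpha H v == 0 by exact: mulr0.
  rewrite -memv_ker alphaA; move: vT; apply/subvP.
  by apply: (bigcapv_inf H) => //; rewrite !inE HH0.
have TS : flat_space T = flat_space S.
  rewrite [RHS]/flat_space (bigD1 H0) //=.
  have -> : (\bigcap_(i in S | i != H0) val i)%VS = flat_space T.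
    by apply: eq_bigl => H; rewrite !inE andbC.
  by apply/esym/capv_idPr.
(* By [TH0], [T] has two elements: if it were empty, [H0] would be all of V, and if it were a
   singleton, its member would be [H0]. *)
have rkT : (\dim (flat_space T)).+2 = \dim {:V}.
  have : (#|T| <= 2)%N by move: S3; rewrite (cardsD1 H0 S) H0S add1n ltnS.
  case Tn : #|T| => [|[|[|//]]] _.
  - move: TH0; rewrite /flat_space (cards0_eq Tn) big_set0 => /dimvS.
    by rewrite -(hypA H0) ltnn.
  - move/eqP: Tn TH0 => /cards1P[G TG]; rewrite /flat_space TG big_set1.
    move/hyperplane_inj => GH; have : G \in T by rewrite TG inE.
    by rewrite GH !inE eqxx.
  - move/eqP: Tn => /cards2P[G [H [GH TE]]].
    by rewrite /flat_space TE big_setU1 ?inE //= big_set1 dim_hyperplane_cap.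
pose F : {set A} := [set H | (flat_space S <= val H)%VS]%SET.
have SF : S \subset F.
  by apply/fintype.subsetP => H HS; rewrite inE; exact: (bigcapv_inf H).
have FS : flat_space F = flat_space S.
  apply/eqP; rewrite eqEsubv; apply/andP; split.
    by apply/subv_bigcapP => H HS; apply: (bigcapv_inf H) => //; exact: (fintype.subsetP SF).
  by apply/subv_bigcapP => H; rewrite inE.
have Fflat : is_flat F && (flat_rank F == 2%N).
  apply/andP; split; first by rewrite /is_flat FS.
  by rewrite /flat_rank FS -TS; lia.
apply: (subvP (sumv_sup F Fflat (subvv _))); rewrite memv_cap cK /=.
apply/coord_subspaceP => H HF; move/coord_subspaceP: cS; apply.
by apply: contra HF; exact: (fintype.subsetP SF).
Qed.

Lemma form_neq0 H : exists v, (alpha H v : R) != 0.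
Proof.
apply: contrapT => h.
suff : (fullv <= val H)%VS.
  by move/dimvS; rewrite -(hypA H) ltnn.
apply/subvP => v _; rewrite -alphaA memv_ker.
by apply: contrapT => /negP fv; apply: h; exists v.
Qed.

(** Treat the hyperplanes one at a time: when the entry at [H] vanishes, move along a vector [u] off
    [H] by a step too small to change the sign of any nonzero entry. *)
Lemma generic_perturbation (w : A -> R) :
  exists v, forall H, (w H + (alpha H v : R) != 0) /\
    (w H != 0 -> 0 < w H * (w H + (alpha H v : R))).
Proof.
suff h (s : seq A) : exists v,
    (forall H, H \in s -> w H + (alpha H v : R) != 0) /\
    (forall H, w H != 0 -> 0 < w H * (w H + (alpha H v : R))).
  by have [v [v1 v2]] := h (enum [set: A]%SET); exists v => H; split; [apply: v1; rewrite mem_enum inE|exact: v2].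
elim: s => [|H s [v [vs vw]]].
  exists 0; split => // H wH; rewrite linear0.
  by change (0 < w H * (w H + 0)); rewrite addr0 -expr2 exprn_even_gt0.
have [aH|aH] := eqVneq (w H + (alpha H v : R)) 0; last first.
  by exists v; split => // G; rewrite inE => /orP[/eqP ->|/vs].
have [u uH] := form_neq0 H.
have [t t0 tP] := sign_preserving_perturbation
  (fun G => w G + (alpha G v : R)) (fun G => alpha G u : R).
have newE G : w G + (alpha G (t *: u + v) : R) =
    w G + (alpha G v : R) + t * (alpha G u : R).
  by rewrite linearP -addrA; congr (_ + _); rewrite addrC.
exists (t *: u + v); split=> G; rewrite newE.
  rewrite inE => /orP[/eqP ->|/vs/tP]; first by rewrite aH add0r mulf_neq0 // gt_eqF.
  by apply: contraTneq => ->; rewrite mulr0 ltxx.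
move=> wG; have aG := vw G wG.
have /tP h : w G + (alpha G v : R) != 0.
  by apply: contraTneq aG => ->; rewrite mulr0 ltxx.
rewrite -(pmulr_rgt0 _ aG) mulrACA -expr2.
by rewrite mulr_gt0 // exprn_even_gt0.
Qed.

(** The form [x *: alpha H] also has kernel [H], so its positive half-space is a component of the
    complement, hence one of the two sides; the sign of [x] selects which. *)
Lemma side_halfspace (side : A -> bool -> set V) : is_coorientation side ->
  forall (H : A) (x : R), x != 0 ->
  exists b, side H b = [set v | 0 < (alpha H v : R) * x].
Proof.
move=> sideP H x x0; have [_ sideH] := sideP H.
pose f : 'Hom(V, R^o) := x *: alpha H.
have fE v : (f v : R) = (alpha H v : R) * x by rewrite scale_lfunE mulrC.
have f0 : f != 0.
  have [v aHv] := form_neq0 H; apply: contraNneq (mulf_neq0 aHv x0) => f0.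
  by rewrite -fE f0 lfunE.
have kf : lker f = val H.
  apply/vspaceP => v; rewrite -alphaA !memv_ker.
  by rewrite -[f v]/(f v : R) fE mulf_eq0 (negPf x0) orbF.
have := halfspace_component f0; rewrite kf -sideH => -[b _ sb].
by exists b; rewrite sb; apply/seteqP; split => v /=; rewrite fE.
Qed.

End Arrangement.

(** * Yoshinaga's criterion and formality *)

Lemma yoshinaga_consistent (R : realType) (V : vectType R) (A : {fset {vspace V}})
    (side : A -> bool -> set V) (r : nat) (eps : {ffun A -> bool}) :
  yoshinaga side r -> consistent side 2 eps -> consistent side r eps.
Proof.
move=> Y eps2; have [r2|r2] := leqP r 2.
  by move=> S Sr; apply: eps2; apply: leq_trans Sr _.
(* For [r > 2] the r-consistent sign vectors are among the 2-consistent ones; equal cardinalities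
   force the two sets to coincide. *)
have sub : [pred e | `[< consistent side r e >]] \subset [pred e | `[< consistent side 2 e >]].
  apply/fintype.subsetP => e; rewrite !inE => er S S2.
  by apply: er; apply: leq_trans S2 _; rewrite ltnS; exact: ltnW.
have /(_ sub eps) := subset_cardP (esym Y).
by rewrite !inE => epsE; apply/asboolP; rewrite epsE; exact/asboolP.
Qed.

Theorem theorem3p6 (R : realType) (r : nat) (V : vectType R)
    (dimV : \dim {:V} = r) (A : {fset {vspace V}})
    (arrA : is_essential_arrangement A)
    (side : A -> bool -> set V) (side_coor : is_coorientation side)
    (alpha : A -> 'Hom(V, R^o)) (alphaA : is_defining_forms alpha) :
  yoshinaga side r -> formal alpha.
Proof.
move=> Y; have [hypA _] := arrA.
rewrite /formal -/(rank2_relations alpha); set K := lker _; set K2 := rank2_relations _.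
have K2K : (K2 <= K)%VS by apply/subv_sumP => F _; exact: capvSl.
apply/eqP; rewrite eqEsubv K2K andbT; apply: contraT => /minimal_support.
case=> k [kK kK2 disj suppk]; rewrite (capv_idPl K2K) in disj.
have [w [wK2 wk]] := orthogonal_extension (fun H => k H : R) disj.
have [u uP] := generic_perturbation hypA alphaA w.
pose x H := w H + (alpha H u : R).
(* Perturbing keeps orthogonality to [K2]: the values of the forms at [u] pair to zero with every
   relation. *)
have xK2 c : c \in K2 -> dot c x = 0.
  move=> cK2; have /form_relationP/(_ u) := subvP K2K _ cK2.
  have -> : dot c x = dot c w + dot c (fun H => alpha H u).
    by rewrite /dot -big_split; apply: eq_bigr => H _; exact: mulrDr.
  by rewrite wK2 // => ->; rewrite addr0.
have /choice[eps epsP] : forall H, exists b, side H b = [set v | 0 < (alpha H v : R) * x H].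
  by move=> H; apply: side_halfspace => //; have [] := uP H.
have eps2 : consistent side 2 (finfun eps).
  move=> S S3; have [|v vx] := forms_interpolation (alpha := alpha) (S := S) (w := x).
    by move=> c cK cS; apply: xK2; exact: small_relation cS.
  exists v => H HS; rewrite ffunE epsP /= vx // -expr2 exprn_even_gt0 //=.
  by have [] := uP H.
have [|v vP] := yoshinaga_consistent Y eps2 (S := supp k).
  (* The support bound is one more than the dimension of V^*, that is [r.+1], exactly the size that
     r-consistency allows. *)
  by rewrite -dimV; apply: leq_trans suppk _; rewrite ltnS !dimvf /dim /= muln1.
(* On the support [x] has the sign of [w], which equals [k] there, and [v] gives [alpha H] the sign
   of [x H]. *)
have pos H : H \in supp k -> 0 < (k H : R) * (alpha H v : R).
  move=> Hk; have := vP H Hk; rewrite ffunE epsP /= => vx.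
  have [xH0 wxH] := uP H.
  have kx : 0 < (k H : R) * x H.
    by rewrite -(wk H Hk) wxH // wk //; move: Hk; rewrite inE.
  have x2 : 0 < x H ^+ 2 by rewrite exprn_even_gt0.
  by rewrite -(pmulr_lgt0 _ x2) expr2 mulrACA mulr_gt0.
have k0 : k != 0 by apply: contraNneq kK2 => ->; exact: mem0v.
have [G kG] := ffun_neq0 k0; have Gk : G \in supp k by rewrite inE.
have /form_relationP/(_ v) := kK; rewrite /dot (bigD1 G) //= => /eqP.
rewrite gt_eqF // ltr_pwDl ?pos // sumr_ge0 // => H _.
have [/pos/ltW //|] := boolP (H \in supp k).
by rewrite inE negbK => /eqP ->; rewrite mul0r.
Qed.
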